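(* Let $\mathcal{C}\subset\mathbb{R}^d$ be a proper cone, and let $n\geq 2$ be an integer. Then $\mathcal{C}_n^{\min}=\mathcal{C}_n^{\max}$ if and only if $\mathcal{C}$ is classical.
   Context: A (convex) cone in a finite-dimensional real vector space $V$ is a subset $\mathcal{C}\subset V$ with $sx+ty\in\mathcal{C}$ for all $x,y\in\mathcal{C}$ and $s,t\in[0,\infty)$. It is proper if it is closed, $\mathcal{C}\cap(-\mathcal{C})=\{0\}$ and $\mathcal{C}-\mathcal{C}=V$. It is classical if there is a vector space basis $A$ of $V$ such that $\mathcal{C}$ is the cone generated by $A$. The dual cone is $\mathcal{C}^*=\{f\in V^* : f\geq 0 \text{ on } \mathcal{C}\}$. For cones $\mathcal{C}_1\subset V_1$, $\mathcal{C}_2\subset V_2$, put $\mathcal{C}_1\odot_{\min}\mathcal{C}_2=\operatorname{conv}\{x_1\otimes x_2 : x_1\in\mathcal{C}_1,\ x_2\in\mathcal{C}_2\}$ and $\mathcal{C}_1\otimes_{\max}\mathcal{C}_2=\{z\in V_1\otimes V_2 : (f_1\otimes f_2)(z)\geq 0 \text{ for every } f_1\in\mathcal{C}_1^*,\ f_2\in\mathcal{C}_2^*\}$ (real tensor products). Let $\mathbb{H}_n$ be the real vector space of $n\times n$ complex Hermitian matrices and $\mathrm{PSD}_n\subset\mathbb{H}_n$ the cone of positive semidefinite matrices; $\mathbb{R}^d\otimes\mathbb{H}_n$ is identified with $\mathbb{H}_n^d$. An operator system in $d$ variables is a sequence $(\mathcal{C}_n)_{n\geq 1}$ of proper cones $\mathcal{C}_n\subset\mathbb{H}_n^d$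 such that for every $m\times n$ matrix $B$, $(A_1,\dots,A_d)\in\mathcal{C}_n$ implies $(BA_1B^\dagger,\dots,BA_dB^\dagger)\in\mathcal{C}_m$ (the choice of order units is ignored). Given a proper cone $\mathcal{C}\subset\mathbb{R}^d$, $(\mathcal{C}_n^{\min})_{n\ge1}$ and $(\mathcal{C}_n^{\max})_{n\ge1}$ denote the minimal and the maximal operator system (with respect to inclusion at each level $n$) whose first-level cone is $\mathcal{C}$; they are given by $$\mathcal{C}_n^{\min}=\mathcal{C}\odot_{\min}\mathrm{PSD}_n,\qquad \mathcal{C}_n^{\max}=\mathcal{C}\otimes_{\max}\mathrm{PSD}_n,$$ which may be taken as their definition. *)

(* Defs.v *)
From HB Require Import structures.
From mathcomp Require Import all_boot all_order all_algebra.
From mathcomp Require Import complex.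
From mathcomp Require Import all_classical all_reals all_analysis.

Set Implicit Arguments.
Unset Strict Implicit.
Unset Printing Implicit Defensive.

Import Order.TTheory GRing.Theory Num.Theory.
Import numFieldNormedType.Exports.

Local Open Scope classical_set_scope.
Local Open Scope ring_scope.
Local Open Scope complex_scope.
Local Open Scope sesquilinear_scope.

Section Cones.
Variable R : realType.

Definition is_cone (V : lmodType R) (C : set V) : Prop :=
  forall (x y : V) (s t : R),
    C x -> C y -> 0 <= s -> 0 <= t -> C (s *: x + t *: y).

Definition proper_cone (d : nat) (C : set 'rV[R]_d) : Prop :=
  [/\ is_cone C,
      closed C,
      C `&` [set - x | x in C] = [set 0] &
      [set x - y | x in C & y in C] = setT].

Definition generated_cone (V : lmodType R) (A : seq V) : set V :=
  [set \sum_(i < size A) c i *: A`_i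
     | c in [set c : 'I_(size A) -> R | forall i, 0 <= c i]].

Definition classical_cone (V : vectType R) (C : set V) : Prop :=
  exists A : seq V, basis_of fullv A /\ C = generated_cone A.

Definition dual_cone (V : lmodType R) (C : set V) : set {scalar V} :=
  [set f : {scalar V} | forall x, C x -> 0 <= f x].

Definition convex_hull (V : lmodType R) (A : set V) : set V :=
  [set z | exists (N : nat) (w : 'I_N -> R) (p : 'I_N -> V),
     [/\ forall i, 0 <= w i,
         \sum_i w i = 1,
         forall i, A (p i) &
         z = \sum_i w i *: p i]].

End Cones.

(* The tensor product of 'rV[R]_d with V is realised as d-tuples of vectors
   of V, the tuple z standing for \sum_i e_i (x) z_i. *)
Section Tensor.
Variables (R : realType) (d : nat) (V : lmodType R).

Definition tens (x : 'rV[R]_d) (y : V) : {ffun 'I_d -> V} :=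
  [ffun i => x 0 i *: y].

Definition tens_fun (f : {scalar 'rV[R]_d}) (g : {scalar V})
    (z : {ffun 'I_d -> V}) : R :=
  \sum_i f (delta_mx 0 i) * g (z i).

Lemma tens_funE (f : {scalar 'rV[R]_d}) (g : {scalar V}) x y :
  tens_fun f g (tens x y) = f x * g y.
Proof.
rewrite /tens_fun [in RHS](row_sum_delta x) linear_sum mulr_suml.
by apply: eq_bigr => i _; rewrite ffunE !linearZ /= mulrCA mulrA.
Qed.

Definition min_tensor (C1 : set 'rV[R]_d) (C2 : set V) :
    set {ffun 'I_d -> V} :=
  convex_hull [set tens x y | x in C1 & y in C2].

Definition max_tensor (C1 : set 'rV[R]_d) (C2 : set V) :
    set {ffun 'I_d -> V} :=
  [set z | forall (f : {scalar 'rV[R]_d}) (g : {scalar V}),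
     dual_cone C1 f -> dual_cone C2 g -> 0 <= tens_fun f g z].

End Tensor.

Section HermitianSpace.
Variables (R : realType) (n : nat).

Definition is_herm : pred 'M[R[i]]_n := fun A => A \is hermsymmx.

Fact is_hermP (A : 'M[R[i]]_n) : reflect (A = A ^t*) (A \in is_herm).
Proof. by apply: (iffP (is_hermitianmxP _ _ _)); rewrite expr0 scale1r. Qed.

Fact is_herm_zmod_closed : zmod_closed is_herm.
Proof.
split=> [|A B /is_hermP hA /is_hermP hB]; apply/is_hermP.
  by rewrite trmx0 map_mx0.
by rewrite linearB /= map_mxB -hA -hB.
Qed.

HB.instance Definition _ :=
  GRing.isZmodClosed.Build 'M[R[i]]_n is_herm is_herm_zmod_closed.

Record herm := Herm { herm_mx : 'M[R[i]]_n; _ : herm_mx \in is_herm }.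

HB.instance Definition _ := [isSub for herm_mx].
HB.instance Definition _ := [Choice of herm by <:].
HB.instance Definition _ := [SubChoice_isSubZmodule of herm by <:].

Fact herm_scale_subproof (a : R) (A : herm) :
  a%:C *: herm_mx A \in is_herm.
Proof.
have /is_hermP hA := valP A.
apply/is_hermP; rewrite linearZ /= map_mxZ -hA.
by congr (_ *: _); exact/esym/conjc_real.
Qed.

Definition herm_scale (a : R) (A : herm) : herm :=
  Herm (herm_scale_subproof a A).

Fact herm_scaleA a b A : herm_scale a (herm_scale b A) = herm_scale (a * b) A.
Proof. by apply: val_inj; rewrite /= scalerA -rmorphM. Qed.

Fact herm_scale1 : left_id 1 herm_scale.
Proof. by move=> A; apply: val_inj; rewrite /= scale1r. Qed.

Fact herm_scaleDr : right_distributive herm_scale +%R.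
Proof. by move=> a A B; apply: val_inj; rewrite !raddfD /= scalerDr. Qed.

Fact herm_scaleDl A : {morph herm_scale^~ A : a b / a + b}.
Proof.
by move=> a b; apply: val_inj; rewrite raddfD /= rmorphD scalerDl.
Qed.

HB.instance Definition _ := GRing.Zmodule_isLmodule.Build R herm
  herm_scaleA herm_scale1 herm_scaleDr herm_scaleDl.

Lemma herm_mxD (A B : herm) : herm_mx (A + B) = herm_mx A + herm_mx B.
Proof. by []. Qed.

Lemma herm_mxZ (a : R) (A : herm) : herm_mx (a *: A) = a%:C *: herm_mx A.
Proof. by []. Qed.

Definition PSD : set herm :=
  [set A : herm | forall v : 'cV[R[i]]_n, 0 <= (v ^t* *m herm_mx A *m v) 0 0].

End HermitianSpace.

Section OperatorSystems.
Variables (R : realType) (d : nat) (C : set 'rV[R]_d) (n : nat).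

Definition opsys_min : set {ffun 'I_d -> herm R n} := min_tensor C (@PSD R n).

Definition opsys_max : set {ffun 'I_d -> herm R n} := max_tensor C (@PSD R n).

End OperatorSystems.

Arguments opsys_min {R d} C n _.
Arguments opsys_max {R d} C n _.

(* Main.v *)
(* With R^n tensored by the real symmetric 2x2 matrices, an element of the
   maximal tensor product is a quadratic form s^2 p + 2st r + t^2 q taking its
   values in C, and it lies in the minimal one when it is a finite sum of
   positive semidefinite scalar forms times vectors of C.  If all forms split
   in this way, then C is a linear image of an orthant, by induction on the dimension.
   The largest ball in C around an interior point touches the boundary at a
   face F = C /\ ker f; splitting the discs of that ball through the contact
   point shows that F spans ker f, so F is a facet, and F inherits the splitting
   property: in suitable coordinates it is an orthant.  The slice f = 1 of C is
   then stable under entrywise minima, because for a and b in it, with m their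
   minimum, u = b - m and v = a - m, the form s^2 m + 2 t^2 u + 2 (s - t)^2 v
   has values in C, and its splitting exhibits m as an element of C.  Hence the
   slice has a least element, which together with F generates C. *)
Require Import Defs.
From HB Require Import structures.
From mathcomp Require Import all_boot all_order all_algebra.
From mathcomp Require Import complex ring lra.
From mathcomp Require Import all_classical all_reals all_analysis.

Set Implicit Arguments.
Unset Strict Implicit.
Unset Printing Implicit Defensive.

Import Order.TTheory GRing.Theory Num.Theory.
Import numFieldNormedType.Exports.

Local Open Scope classical_set_scope.
Local Open Scope ring_scope.

(** * Euclidean inner product of row vectors *)

Section DotProduct.
Context {R : realType} {d : nat}.
Implicit Types x y z f : 'rV[R]_d.

Definition dot x y : R := (x *m y^T) 0 0.

Lemma dotE x y : dot x y = \sum_i x 0 i * y 0 i.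
Proof. by rewrite /dot mxE; apply: eq_bigr => i _; rewrite mxE. Qed.

Lemma dotC x y : dot x y = dot y x.
Proof. by rewrite !dotE; apply: eq_bigr => i _; rewrite mulrC. Qed.

Lemma dotDl x y z : dot (x + y) z = dot x z + dot y z.
Proof. by rewrite /dot mulmxDl mxE. Qed.

Lemma dotZl a x z : dot (a *: x) z = a * dot x z.
Proof. by rewrite /dot -scalemxAl mxE. Qed.

Lemma dotDr x y z : dot z (x + y) = dot z x + dot z y.
Proof. by rewrite !(dotC z) dotDl. Qed.

Lemma dotZr a x z : dot z (a *: x) = a * dot z x.
Proof. by rewrite !(dotC z) dotZl. Qed.

Lemma dotNl x z : dot (- x) z = - dot x z.
Proof. by rewrite -scaleN1r dotZl mulN1r. Qed.

Lemma dotNr x z : dot z (- x) = - dot z x.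
Proof. by rewrite !(dotC z) dotNl. Qed.

Lemma dot0r x : dot x 0 = 0.
Proof. by rewrite -(scale0r 0) dotZr mul0r. Qed.

Lemma dot_sumr I (s : seq I) (P : pred I) (F : I -> 'rV[R]_d) x :
  dot x (\sum_(i <- s | P i) F i) = \sum_(i <- s | P i) dot x (F i).
Proof.
by elim/big_ind2: _ => [|u a v b <- <-|//]; rewrite ?dot0r// dotDr.
Qed.

Definition dot_lin := (dotDl, dotDr, dotZl, dotZr, dotNl, dotNr).

Lemma dot_ge0 x : 0 <= dot x x.
Proof. by rewrite dotE sumr_ge0// => i _; rewrite -expr2 sqr_ge0. Qed.

Lemma dot_gt0 x : x != 0 -> 0 < dot x x.
Proof.
move=> x0; rewrite lt_neqAle dot_ge0 andbT eq_sym; apply: contra x0 => /eqP.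
rewrite dotE => /eqP; rewrite psumr_eq0; last by move=> i _; rewrite -expr2 sqr_ge0.
move=> /allP xi0; apply/eqP/rowP => i; rewrite mxE.
by have := xi0 i (mem_index_enum _); rewrite mulf_eq0 orbb => /eqP.
Qed.

Lemma dot_normalize x : x != 0 ->
  exists2 a : R, 0 < a & dot (a *: x) (a *: x) = 1.
Proof.
move=> /dot_gt0 x0; have s0 : 0 < Num.sqrt (dot x x) by rewrite sqrtr_gt0.
exists (Num.sqrt (dot x x))^-1; rewrite ?invr_gt0// dotZl dotZr mulrA -invfM.
by rewrite -expr2 sqr_sqrtr ?ltW// mulVf// gt_eqF.
Qed.

Lemma dot_mulmx n x (y : 'rV[R]_n) (N : 'M[R]_(n, d)) :
  dot x (y *m N) = (x *m N^T *m y^T) 0 0.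
Proof. by rewrite /dot trmx_mul mulmxA. Qed.

(* Cauchy-Schwarz, for a unit vector x. *)
Lemma dot_ge_unit x y (k : R) : dot x x = 1 -> 0 <= k -> dot y y <= k ^+ 2 ->
  - k <= dot x y.
Proof.
move=> x1 k0 yk; have := dot_ge0 (k *: x + y).
rewrite !dot_lin x1 (dotC y x) => h.
have [k1|k1] := ltP 0 k; first by nra.
have {k0 k1} kE : k = 0 by apply/eqP; rewrite eq_le k0 k1.
move: yk; rewrite kE expr0n/= => yk.
have [->|/dot_gt0] := eqVneq y 0; first by rewrite dot0r oppr0.
by lra.
Qed.

End DotProduct.

(** * Cones, duality and the splitting property *)

Section ConeBasics.
Context {R : realType} {V : lmodType R}.
Variable C : set V.
Hypothesis hC : is_cone C.

Lemma coneD x y : C x -> C y -> C (x + y).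
Proof. by move=> cx cy; have := hC cx cy ler01 ler01; rewrite !scale1r. Qed.

Lemma coneZ a x : 0 <= a -> C x -> C (a *: x).
Proof. by move=> a0 cx; have := hC cx cx a0 (lexx 0); rewrite scale0r addr0. Qed.

Lemma cone_sum I (s : seq I) (P : pred I) (F : I -> V) : C 0 ->
  (forall i, P i -> C (F i)) -> C (\sum_(i <- s | P i) F i).
Proof. by move=> c0 cF; elim/big_ind: _ => //; exact: coneD. Qed.

End ConeBasics.

(** Functionals are encoded as vectors, so that dual elements can be normalized and a minimum taken
    over them. *)
Definition dualv {R : realType} {d} (C : set 'rV[R]_d) : set 'rV[R]_d :=
  [set f | forall x, C x -> 0 <= dot f x].

(* Every positive linear map from the real symmetric 2x2 matrices to [C] is
   separable (entanglement breaking); the map sending the rank one matrix of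
   (s, t) to [s ^+ 2 *: p + (2 * s * t) *: r + t ^+ 2 *: q] is encoded by
   [p], [r] and [q]. *)
Definition quadratic_splitting {R : realType} {d} (C : set 'rV[R]_d) : Prop :=
  forall p r q : 'rV[R]_d,
    (forall s t : R, C (s ^+ 2 *: p + (2 * s * t) *: r + t ^+ 2 *: q)) ->
  exists (N : nat) (x : 'I_N -> 'rV[R]_d) (a b c : 'I_N -> R),
    [/\ forall i, C (x i),
        forall i s t, 0 <= s ^+ 2 * a i + 2 * s * t * b i + t ^+ 2 * c i,
        p = \sum_i a i *: x i,
        r = \sum_i b i *: x i &
        q = \sum_i c i *: x i].

(* Closedness is recorded as the bidual property, which passes to faces and
   linear images without topology. *)
Record splitting_cone {R : realType} {d} (C : set 'rV[R]_d) : Prop :=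
  SplittingCone {
    sc_cone : is_cone C;
    sc_bidual : forall p, (forall f, dualv C f -> 0 <= dot f p) -> C p;
    sc_pointed : forall x, C x -> C (- x) -> x = 0;
    sc_gen : forall x, exists a b, [/\ C a, C b & x = a - b];
    sc_split : quadratic_splitting C }.

(** * Nonnegative binary quadratic forms *)

Section QuadraticForm.
Context {R : realType}.
Variables a b c : R.
Hypothesis abc : forall s t, 0 <= s ^+ 2 * a + 2 * s * t * b + t ^+ 2 * c.

Lemma qform_a_ge0 : 0 <= a.
Proof. by have := abc 1 0; lra. Qed.

Lemma qform_c_ge0 : 0 <= c.
Proof. by have := abc 0 1; lra. Qed.

Lemma qform_a0 : a = 0 -> b = 0.
Proof.
(* At this point the form takes the value [- (c + 2) * b ^+ 2]. *)
move=> a0; have := abc (- (c + 1)) b; have := qform_c_ge0; rewrite a0 => c0 h.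
have : b ^+ 2 <= 0 by nra.
by rewrite le_eqVlt ltNge sqr_ge0 orbF sqrf_eq0 => /eqP.
Qed.

Lemma qform_c0 : c = 0 -> b = 0.
Proof.
move=> c0; have := abc b (- (a + 1)); have := qform_a_ge0; rewrite c0 => a0 h.
have : b ^+ 2 <= 0 by nra.
by rewrite le_eqVlt ltNge sqr_ge0 orbF sqrf_eq0 => /eqP.
Qed.

End QuadraticForm.

(** * The face at the contact point of an inscribed ball *)

Lemma splitting_cone0 {R : realType} {d} (C : set 'rV[R]_d) : splitting_cone C -> C 0.
Proof.
move=> hC; have [a [b [ca _ _]]] := sc_gen hC 0.
by rewrite -(scale0r a); exact: coneZ (sc_cone hC) _ _ _ _.
Qed.

(* The disc [s^2 + t^2 = 1] is sent into the ball of radius [dot f x0] around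
   [x0], which touches the boundary of [C] on the face where [f] vanishes;
   a term of the splitting with [a i <> 0] lies in that face. *)
Lemma facet_span {R : realType} {d} (C : set 'rV[R]_d) (x0 f : 'rV[R]_d) :
  splitting_cone C -> dualv C f -> dot f f = 1 -> 0 < dot f x0 ->
  (forall g, dualv C g -> dot g g = 1 -> dot f x0 <= dot g x0) ->
  forall w, dot f w = 0 ->
  exists a b, [/\ C a, C b, dot f a = 0, dot f b = 0 & w = a - b].
Proof.
move=> hC Cf f1; set r := dot f x0 => r0 rmin w fw.
(* This factor brings the norm of [k *: w] below 1 without a square root. *)
pose k := (1 + dot w w)^-1; have w0 := dot_ge0 w.
have k0 : 0 < k by rewrite invr_gt0; lra.
have kw : k ^+ 2 * dot w w <= 1.
  have kE : k * (1 + dot w w) = 1 by rewrite mulVf// gt_eqF//; lra.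
  by nra.
(* The form equals [(s ^+ 2 + t ^+ 2) *: x0 + r *: y] for the [y] below; its value at (1, 0) is the
   contact point, where [f] vanishes. *)
have [|N [x [a [b [c [Cx abc pE rE _]]]]]] :=
  sc_split hC (p := x0 - r *: f) (r := (r * k) *: w) (q := x0 + r *: f).
  move=> s t; apply: sc_bidual => // g Cg.
  have [->|/dot_normalize[e e0 eg]] := eqVneq g 0; first by rewrite dotC dot0r.
  rewrite -(pmulr_rge0 _ e0) -dotZl; have := rmin (e *: g).
  have Ceg : dualv C (e *: g).
    by move=> y Cy; rewrite dotZl; apply: mulr_ge0; [exact: ltW|exact: Cg].
  move=> /(_ Ceg eg) rg.
  (* As [w] is orthogonal to [f], the norm of [y] is at most [s ^+ 2 + t ^+ 2]; Cauchy-Schwarz and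
     the minimality of [r] then make the form nonnegative against [e *: g]. *)
  pose y := (t ^+ 2 - s ^+ 2) *: f + (2 * s * t * k) *: w.
  have := @dot_ge_unit _ _ (e *: g) y (s ^+ 2 + t ^+ 2) eg.
  have yy : dot y y <= (s ^+ 2 + t ^+ 2) ^+ 2.
    have -> : dot y y = (t ^+ 2 - s ^+ 2) ^+ 2
        + 4 * (s * t) ^+ 2 * (k ^+ 2 * dot w w).
      by rewrite /y !dot_lin f1 (dotC w f) fw; ring.
    by have := sqr_ge0 (s * t); nra.
  have st0 : 0 <= s ^+ 2 + t ^+ 2 by rewrite addr_ge0 ?sqr_ge0.
  move=> /(_ st0 yy) gy.
  rewrite [X in 0 <= X](_ : _ = (s ^+ 2 + t ^+ 2) * dot (e *: g) x0
    + r * dot (e *: g) y); last by rewrite /y !dot_lin; ring.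
  by nra.
(* These terms are nonnegative and sum to the value of [f] at the contact point, which is 0. *)
have fx0 i : a i * dot f (x i) = 0.
  have : \sum_i a i * dot f (x i) = 0.
    under eq_bigr do rewrite -dotZr.
    by rewrite -dot_sumr -pE !dot_lin f1 -/r; ring.
  move/eqP; rewrite psumr_eq0 => [|j _]; last first.
    by rewrite mulr_ge0 ?(qform_a_ge0 (abc j)) ?Cf.
  by move=> /allP /(_ i (mem_index_enum _)) /eqP.
have bx0 i : b i * dot f (x i) = 0.
  have /eqP := fx0 i; rewrite mulf_eq0 => /orP[/eqP a0|/eqP ->]; last first.
    by rewrite mulr0.
  by rewrite (qform_a0 (abc i) a0) mul0r.
(* [h] undoes the factor [r * k]; the positive and negative parts of the [b i] give the two vectors
   of the face. *)
pose h := (r * k)^-1; have h0 : 0 < h by rewrite invr_gt0 mulr_gt0.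
exists (\sum_i (h * Num.max (b i) 0) *: x i),
  (\sum_i (h * Num.max (- b i) 0) *: x i); split.
- apply: cone_sum (sc_cone hC) _ _ _ _ (splitting_cone0 hC) _ => i _.
  by apply: coneZ (sc_cone hC) _ _ _ (Cx i); rewrite mulr_ge0 ?(ltW h0)//
    le_max lexx orbT.
- apply: cone_sum (sc_cone hC) _ _ _ _ (splitting_cone0 hC) _ => i _.
  by apply: coneZ (sc_cone hC) _ _ _ (Cx i); rewrite mulr_ge0 ?(ltW h0)//
    le_max lexx orbT.
- rewrite dot_sumr big1// => i _; rewrite dotZr.
  have /eqP := bx0 i; rewrite mulf_eq0 => /orP[/eqP ->|/eqP ->].
    by rewrite maxxx mulr0 mul0r.
  by rewrite mulr0.
- rewrite dot_sumr big1// => i _; rewrite dotZr.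
  have /eqP := bx0 i; rewrite mulf_eq0 => /orP[/eqP ->|/eqP ->].
    by rewrite oppr0 maxxx mulr0 mul0r.
  by rewrite mulr0.
- have -> : w = h *: \sum_i b i *: x i.
    by rewrite -rE scalerA mulVf ?scale1r// gt_eqF// mulr_gt0.
  rewrite scaler_sumr -sumrB; apply: eq_bigr => i _.
  rewrite -scalerBl scalerA -mulrBr; congr (_ *: _); congr (_ * _).
  by rewrite /Num.max; do 2 case: ifPn; rewrite -?leNgt; lra.
Qed.

(** * Compactness and the bidual property of closed cones *)

Section Compactness.
Context {R : realType} {d : nat}.
Implicit Types x y p f : 'rV[R]_d.

Lemma sum_continuous (T : topologicalType) I (s : seq I) (F : I -> T -> R) :
  (forall i, continuous (F i)) -> continuous (fun t => \sum_(i <- s) F i t).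
Proof.
move=> cF t; elim: s => [|i s IH].
  by under eq_fun do rewrite big_nil; exact: cvg_cst.
under eq_fun do rewrite big_cons.
by apply: cvgD IH; exact: cF.
Qed.

Lemma dotr_continuous y : continuous (fun x => dot x y).
Proof.
have -> : (fun x => dot x y) = fun x => \sum_i x 0 i * y 0 i.
  by apply/funext => x; rewrite dotE.
apply: sum_continuous => i x.
by apply: continuousM; [exact: coord_continuous|exact: cst_continuous].
Qed.

Lemma dist2_continuous p : continuous (fun x => dot (x - p) (x - p)).
Proof.
have -> : (fun x => dot (x - p) (x - p)) =
          fun x => \sum_i (x 0 i - p 0 i) * (x 0 i - p 0 i).
  by apply/funext => x; rewrite dotE; under eq_bigr do rewrite !mxE.
apply: sum_continuous => i.
have cB : continuous (fun x : 'rV[R]_d => x 0 i - p 0 i).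
  by move=> x; apply: continuousB; [exact: coord_continuous|exact: cst_continuous].
by move=> x; exact: continuousM (cB x) (cB x).

Qed.

Lemma dot_bounded_compact (A : set 'rV[R]_d) (K : R) : closed A ->
  (forall x, A x -> dot x x <= K) -> compact A.
Proof.
move=> cA AK.
(* The half-width [K + 1] suffices: each coordinate has its square at most [K], hence at most
   [(K + 1) ^+ 2]. *)
have cI : compact [set v : 'rV[R]_d | forall i, v ord0 i \in `[- (K + 1), K + 1]].
  apply: (@rV_compact _ _ (fun=> `[(- (K + 1)), (K + 1)]%classic)) => _.
  exact: segment_compact.
apply: subclosed_compact cA cI _ => x /AK xK i.
have K0 : 0 <= K := le_trans (dot_ge0 x) xK.
have xi : x 0 i ^+ 2 <= K.
  apply: le_trans xK; rewrite dotE (bigD1 i)//= -expr2 lerDl.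
  by apply: sumr_ge0 => j _; rewrite -expr2 sqr_ge0.
by rewrite in_itv/=; apply/andP; split; nra.
Qed.

End Compactness.

Section Projection.
Context {R : realType} {d : nat}.
Variable C : set 'rV[R]_d.
Hypotheses (hC : is_cone C) (clC : closed C) (C0 : C 0).

Lemma nearest_point (p : 'rV[R]_d) : exists2 c, C c &
  forall x, C x -> dot (c - p) (c - p) <= dot (x - p) (x - p).
Proof.
(* Points farther from [p] than 0 can be ignored; the remaining ones have norm at most twice that of
   [p]. *)
pose A := C `&` [set x | dot (x - p) (x - p) <= dot p p].
have A0 : A 0 by split => //=; rewrite sub0r !dot_lin opprK.
have clA : closed A.
  apply: closedI => //.
  have -> : [set x | dot (x - p) (x - p) <= dot p p] =
     (fun x => dot (x - p) (x - p)) @^-1` [set y | y <= dot p p] by [].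
  apply: preimage_closed; [by move=> ? _; exact: dist2_continuous|exact: closed_le].
have cA : compact A.
  apply: (dot_bounded_compact (K := 4 * dot p p)) clA _ => x [_ /=].
  have := dot_ge0 (x - 2 *: p); rewrite !dot_lin (dotC p x); lra.
have [|c /set_mem[Cc cp] cmin] := EVT_min_rV (f := fun x => dot (x - p) (x - p))
  (ex_intro _ 0 A0) cA.
  by apply: continuous_subspaceT; exact: dist2_continuous.
exists c => // x Cx; have [xp|xp] := leP (dot (x - p) (x - p)) (dot p p).
  by apply: cmin; rewrite inE.
by apply: le_trans (ltW xp).
Qed.

(** The point [c] of [C] nearest to [p] yields the separating functional [c - p]: the first order
    conditions at [c] make it nonnegative on [C] and nonpositive at [c], hence negative at [p]
    unless [p = c]. *)
Lemma closed_cone_bidual (p : 'rV[R]_d) :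
  (forall f, dualv C f -> 0 <= dot f p) -> C p.
Proof.
move=> pd; have [c Cc cmin] := nearest_point p.
have [f fE] : exists f, f = c - p by exists (c - p).
(* First order condition: if [u < 0], then at [q = - u / (v - u)], which lies in [0, 1], the
   quadratic equals [q * (1 + q) * u < 0]. *)
have quad (u v : R) : 0 <= v ->
    (forall t, 0 <= t <= 1 -> 0 <= 2 * t * u + t ^+ 2 * v) -> 0 <= u.
  move=> v0 h; rewrite leNgt; apply/negP => u0.
  have w0 : 0 < v - u by lra.
  have q0 : 0 < - u / (v - u) by rewrite divr_gt0//; lra.
  have qE : - u / (v - u) * (v - u) = - u by rewrite divfK// gt_eqF.
  have := h (- u / (v - u)); set q := - u / (v - u) in q0 qE *.
  have -> : 0 <= q <= 1 by apply/andP; split; nra.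
  move=> /(_ isT); nra.
have Cf x : C x -> 0 <= dot f x.
  move=> Cx; apply: (quad _ (dot x x)); first exact: dot_ge0.
  move=> t /andP[t0 _]; have := cmin (c + t *: x).
  have -> : c + t *: x - p = f + t *: x by rewrite fE addrAC.
  move=> /(_ (coneD hC Cc (coneZ hC t0 Cx))).
  rewrite -fE !dot_lin (dotC x f); lra.
have fc : dot f c <= 0.
  rewrite -oppr_ge0; apply: (quad _ (dot c c)); first exact: dot_ge0.
  move=> t /andP[t0 t1]; have := cmin ((1 - t) *: c).
  have -> : (1 - t) *: c - p = f - t *: c by rewrite fE scalerBl scale1r addrAC.
  have t1' : 0 <= 1 - t by lra.
  move=> /(_ (coneZ hC t1' Cc)).
  rewrite -fE !dot_lin (dotC c f); lra.
have := pd f Cf; have -> : dot f p = dot f c - dot f f.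
  by rewrite {4}fE !dot_lin; lra.
have [f0 _|/dot_gt0 ff] := eqVneq f 0; last by lra.
by have -> : p = c by apply/eqP; rewrite eq_sym -subr_eq0 -fE f0.
Qed.

End Projection.

(** [dot f x0] is the radius of the largest ball around [x0] inside [C]; it is attained because the
    unit vectors of the dual cone form a compact set. *)
Lemma dual_minimizer {R : realType} {d} (C : set 'rV[R]_d) : (0 < d)%N ->
  splitting_cone C -> exists x0 f, [/\ dualv C f, dot f f = 1, 0 < dot f x0 &
    forall g, dualv C g -> dot g g = 1 -> dot f x0 <= dot g x0].
Proof.
case: d C => // d C _ hC.
have [x0 [Cx0 x0P]] : exists x0, C x0 /\
    forall f, dualv C f -> dot f x0 = 0 -> f = 0.
  (* [x0] sums cone vectors whose differences are the unit vectors, so a dual vector vanishing at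
     [x0] vanishes on a basis. *)
  have [y] := choice (fun i => sc_gen hC (delta_mx 0 i)).
  move=> /choice[z yz].
  exists (\sum_i (y i + z i)); split.
    apply: cone_sum (sc_cone hC) _ _ _ _ (splitting_cone0 hC) _ => i _.
    by have [? ? _] := yz i; apply: coneD (sc_cone hC) _ _ _ _.
  move=> f Cf; rewrite dot_sumr => /eqP; rewrite psumr_eq0; last first.
    by move=> i _; have [? ? _] := yz i; rewrite dotDr addr_ge0 ?Cf.
  move=> /allP yz0; apply/rowP => i; rewrite mxE.
  have [yi zi ei] := yz i.
  have := yz0 i (mem_index_enum _); rewrite dotDr paddr_eq0 ?Cf//.
  move=> /andP[/eqP fy /eqP fz].
  have : dot f (delta_mx 0 i) = 0 by rewrite ei !dot_lin fy fz subrr.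
  rewrite dotE (bigD1 i)//= big1 ?mxE ?eqxx ?addr0 ?mulr1// => j ji.
  by rewrite mxE (negPf ji) andbF mulr0.
pose A := dualv C `&` [set f | dot f f = 1].
have clA : closed A.
  apply: closedI.
    have -> : dualv C = \bigcap_(x in C) [set f | 0 <= dot f x].
      by apply/seteqP; split => f fC x; exact: fC.
    apply: closed_bigI => x _.
    have -> : [set f | 0 <= dot f x] = (dot^~ x) @^-1` [set y | 0 <= y] by [].
    apply: preimage_closed; [by move=> ? _; exact: dotr_continuous|exact: closed_ge].
  have -> : [set f : 'rV[R]_d.+1 | dot f f = 1] =
     (fun x => dot (x - 0) (x - 0)) @^-1` [set y | y = 1].
    by apply/seteqP; split => f /=; rewrite subr0.
  apply: preimage_closed; [by move=> ? _; exact: dist2_continuous|exact: closed_eq].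
have cA : compact A by apply: (dot_bounded_compact clA (K := 1)) => x [_ /= ->].
(* Otherwise the bidual property makes [C] the whole space, which is not pointed in positive
   dimension. *)
have [f Cf f0] : exists2 f, dualv C f & f != 0.
  apply/not_exists2P => no.
  have all x : C x.
    apply: (sc_bidual hC) => f Cf; have [//|/negP] := no f; rewrite negbK => /eqP ->.
    by rewrite dotC dot0r.
  pose e : 'rV[R]_d.+1 := delta_mx 0 0.
  have := sc_pointed hC (all e) (all (- e)) => /rowP /(_ 0) /eqP.
  by rewrite !mxE eqxx oner_eq0.
have [a a0 af] := dot_normalize f0.
have Aaf : A (a *: f).
  by split => // x Cx; rewrite dotZl; apply: mulr_ge0; [exact: ltW|exact: Cf].
have [|g /set_mem[Cg gg] gmin] := EVT_min_rV (f := fun f => dot f x0)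
  (ex_intro _ _ Aaf) cA.
  by apply: continuous_subspaceT; exact: dotr_continuous.
exists x0, g; split => //.
  rewrite lt_neqAle Cg// andbT eq_sym; apply/eqP => /(x0P _ Cg) g0.
  by move: gg => /=; rewrite g0 dot0r => /eqP; rewrite eq_sym oner_eq0.
by move=> h Ch hh; apply: gmin; rewrite inE.
Qed.

(** Used to turn a supporting functional into the first coordinate, and later a facet into the
    standard orthant. *)
Lemma splitting_cone_mulmx {R : realType} {d} (C : set 'rV[R]_d) (N : 'M[R]_d) :
  N \in unitmx -> splitting_cone C -> splitting_cone [set x | C (x *m N)].
Proof.
move=> uN hC; split.
- move=> x y s t /= Cx Cy s0 t0; rewrite mulmxDl -!scalemxAl.
  exact: sc_cone.
- move=> p hp /=; apply: sc_bidual => // f Cf.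
  rewrite dot_mulmx; apply: hp => x /Cf; by rewrite dot_mulmx.
- move=> x /= Cx; rewrite mulNmx => CNx.
  by rewrite -(mulmxK uN x) (sc_pointed hC Cx CNx) mul0mx.
- move=> x; have [a [b [Ca Cb xE]]] := sc_gen hC (x *m N).
  exists (a *m invmx N), (b *m invmx N); split; rewrite /= ?mulmxKV//.
  by rewrite -mulmxBl -xE mulmxK.
- move=> p r q Cpq.
  have [|k [x [a [b [c [Cx abc pE rE qE]]]]]] :=
    sc_split hC (p := p *m N) (r := r *m N) (q := q *m N).
    by move=> s t; rewrite !scalemxAl -!mulmxDl; exact: Cpq.
  exists k, (fun i => x i *m invmx N), a, b, c; split => //.
  + by move=> i; rewrite /= mulmxKV.
  + rewrite -(mulmxK uN p) pE mulmx_suml.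
    by apply: eq_bigr => i _; rewrite scalemxAl.
  + rewrite -(mulmxK uN r) rE mulmx_suml.
    by apply: eq_bigr => i _; rewrite scalemxAl.
  + rewrite -(mulmxK uN q) qE mulmx_suml.
    by apply: eq_bigr => i _; rewrite scalemxAl.
Qed.

(** * Passing to a facet *)

Section FirstCoordinate.
Context {R : realType} {d : nat}.
Variable C : set 'rV[R]_(1 + d).
Hypotheses (hC : splitting_cone C) (hpos : forall x, C x -> 0 <= lsubmx x 0 0).

Let head0 (x : 'rV[R]_(1 + d)) : lsubmx x 0 0 = 0 -> x = row_mx 0 (rsubmx x).
Proof.
move=> x0; rewrite -[LHS]hsubmxK; congr row_mx.
by apply/rowP => j; rewrite ord1 x0 mxE.
Qed.

Let head_sum I (s : seq I) (F : I -> 'rV[R]_(1 + d)) :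
  lsubmx (\sum_(i <- s) F i) 0 0 = \sum_(i <- s) lsubmx (F i) 0 0.
Proof. by rewrite linear_sum summxE. Qed.

(** A form with values in the facet has first coordinate 0; this coordinate being nonnegative on
    [C], every vector that occurs in a splitting with a nonzero coefficient lies in the facet. *)
Lemma splitting_cone_facet :
  (forall w, lsubmx w 0 0 = 0 -> exists a b, [/\ C a, C b,
     lsubmx a 0 0 = 0, lsubmx b 0 0 = 0 & w = a - b]) ->
  splitting_cone [set y : 'rV[R]_d | C (row_mx 0 y)].
Proof.
move=> hgen; split.
- move=> x y s t /= Cx Cy s0 t0; have := sc_cone hC Cx Cy s0 t0.
  by rewrite !scale_row_mx add_row_mx !scaler0 addr0.
- move=> p hp /=; apply: sc_bidual => // f Cf.
  have fE y : dot f (row_mx 0 y) = dot (rsubmx f) y.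
    rewrite -{1}(hsubmxK f) /dot tr_row_mx mul_row_col.
    by rewrite trmx0 mulmx0 add0r.
  by rewrite fE; apply: hp => y /Cf; rewrite fE.
- move=> x /= Cx CNx; have := sc_pointed hC Cx.
  rewrite opp_row_mx oppr0 => /(_ CNx) /(congr1 (@rsubmx R 1 1 d)).
  by rewrite row_mxKr linear0.
- move=> y; have [|a [b [Ca Cb a0 b0 ab]]] := hgen (row_mx 0 y).
    by rewrite row_mxKl mxE.
  exists (rsubmx a), (rsubmx b); split => /=; rewrite -?head0//.
  by have := congr1 (@rsubmx R 1 1 d) ab; rewrite row_mxKr linearB.
- move=> p r q Cpq.
  have [|k [x [a [b [c [Cx abc pE rE qE]]]]]] :=
    sc_split hC (p := row_mx 0 p) (r := row_mx 0 r) (q := row_mx 0 q).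
    move=> s t; have := Cpq s t => /=.
    by rewrite !scale_row_mx !add_row_mx !scaler0 !addr0.
  have a0 i : a i * lsubmx (x i) 0 0 = 0.
    have /eqP : \sum_i a i * lsubmx (x i) 0 0 = 0.
      transitivity (lsubmx (row_mx 0 p : 'rV[R]_(1 + d)) 0 0).
        by rewrite pE head_sum; apply: eq_bigr => j _; rewrite !mxE.
      by rewrite row_mxKl mxE.
    rewrite psumr_eq0 => [|j _]; last first.
      by rewrite mulr_ge0 ?(qform_a_ge0 (abc j)) ?hpos.
    by move=> /allP /(_ i (mem_index_enum _)) /eqP.
  have c0 i : c i * lsubmx (x i) 0 0 = 0.
    have /eqP : \sum_i c i * lsubmx (x i) 0 0 = 0.
      transitivity (lsubmx (row_mx 0 q : 'rV[R]_(1 + d)) 0 0).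
        by rewrite qE head_sum; apply: eq_bigr => j _; rewrite !mxE.
      by rewrite row_mxKl mxE.
    rewrite psumr_eq0 => [|j _]; last first.
      by rewrite mulr_ge0 ?(qform_c_ge0 (abc j)) ?hpos.
    by move=> /allP /(_ i (mem_index_enum _)) /eqP.
  (* Off the facet all three coefficients vanish, so the vector can be replaced by 0, which is in
     the cone. *)
  pose y i := if lsubmx (x i) 0 0 == 0 then rsubmx (x i) else 0.
  have yE (e : 'I_k -> R) i : (lsubmx (x i) 0 0 != 0 -> e i = 0) ->
      e i *: y i = rsubmx (e i *: x i).
    rewrite /y; case: eqP => [_ _|_ /(_ isT) ->]; first by rewrite linearZ.
    by rewrite !scale0r linear0.
  have aE i : lsubmx (x i) 0 0 != 0 -> a i = 0.
    by move=> xi; have /eqP := a0 i; rewrite mulf_eq0 (negPf xi) orbF => /eqP.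
  have cE i : lsubmx (x i) 0 0 != 0 -> c i = 0.
    by move=> xi; have /eqP := c0 i; rewrite mulf_eq0 (negPf xi) orbF => /eqP.
  have bE i : lsubmx (x i) 0 0 != 0 -> b i = 0.
    by move=> /aE; exact: qform_a0 (abc i).
  exists k, y, a, b, c; split => //.
  + move=> i; rewrite /y /=; case: eqP => [/head0 <-//|_].
    by rewrite row_mx0; exact: splitting_cone0.
  + rewrite -[LHS](row_mxKr (0 : 'cV[R]_1)) pE linear_sum.
    by apply: eq_bigr => i _; rewrite yE//; exact: aE.
  + rewrite -[LHS](row_mxKr (0 : 'cV[R]_1)) rE linear_sum.
    by apply: eq_bigr => i _; rewrite yE//; exact: bE.
  + rewrite -[LHS](row_mxKr (0 : 'cV[R]_1)) qE linear_sum.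
    by apply: eq_bigr => i _; rewrite yE//; exact: cE.
Qed.

(** * The slice at height one over an orthant facet *)

Hypothesis hface : forall y, C (row_mx 0 y) <-> forall i, 0 <= y 0 i.

Let P (y : 'rV[R]_d) := C (row_mx 1 y).

Let P_up (y z : 'rV[R]_d) : P y -> (forall i, y 0 i <= z 0 i) -> P z.
Proof.
move=> Py yz; have /hface Cz : forall i, 0 <= (z - y) 0 i.
  by move=> i; rewrite !mxE subr_ge0.
have := coneD (sc_cone hC) Py Cz.
by rewrite add_row_mx addr0 addrC subrK.
Qed.

(* [al *: row_mx 1 a + be *: row_mx 1 b] with [al + be = s ^+ 2] is a lower bound
   in [C] for the form [s^2 m + 2 t^2 u + 2 (s - t)^2 v]. *)
Let P_min (a b : 'rV[R]_d) : P a -> P b -> P (\row_j Num.min (a 0 j) (b 0 j)).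
Proof.
move=> Pa Pb; set m := \row_j _.
have [u uE] : exists u, u = b - m by exists (b - m).
have [v vE] : exists v, v = a - m by exists (a - m).
have u0 j : 0 <= u 0 j by rewrite uE !mxE subr_ge0 ge_min lexx orbT.
have v0 j : 0 <= v 0 j by rewrite vE !mxE subr_ge0 ge_min lexx.
have uv j : u 0 j = 0 \/ v 0 j = 0.
  by rewrite uE vE !mxE /Num.min; case: ifPn => _; [right|left]; rewrite subrr.
(* These are the coefficients of the form to be split; only that of [s ^+ 2] has height 1. *)
have [|k [x [a' [b' [c' [Cx abc pE rE qE]]]]]] :=
    sc_split hC (p := row_mx 1 (m + 2 *: v)) (r := row_mx 0 (- 2 *: v))
      (q := row_mx 0 (2 *: u + 2 *: v)).
  move=> s t.
  (* When [be = 2 * t ^+ 2], the bound on [al] amounts to [0 <= (s - 2 * t) ^+ 2]. *)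
  pose be := Num.min (s ^+ 2) (2 * t ^+ 2); pose al := s ^+ 2 - be.
  have [al0 be0 bet alst] : [/\ 0 <= al, 0 <= be, be <= 2 * t ^+ 2 &
      al <= 2 * (s - t) ^+ 2].
    have := sqr_ge0 s; have := sqr_ge0 t; have := sqr_ge0 (s - t).
    have := sqr_ge0 (s - 2 * t).
    by rewrite /al /be /Num.min; case: ifPn; rewrite -?leNgt;
      split; lra.
  have /hface Cw : forall j,
      0 <= ((2 * t ^+ 2 - be) *: u + (2 * (s - t) ^+ 2 - al) *: v) 0 j.
    move=> j; rewrite mxE [X in 0 <= X + _]mxE [X in 0 <= _ + X]mxE.
    by rewrite addr_ge0// mulr_ge0// subr_ge0.
  have := coneD (sc_cone hC) (coneD (sc_cone hC) (coneZ (sc_cone hC) al0 Pa)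
    (coneZ (sc_cone hC) be0 Pb)) Cw.
  rewrite !scale_row_mx !add_row_mx !scaler0 !addr0 -scalerDl.
  rewrite /al subrK; congr (C (row_mx _ _)).
  by apply/rowP => j; rewrite uE vE !mxE; ring.
have c0 i : c' i * lsubmx (x i) 0 0 = 0.
  have /eqP : \sum_i c' i * lsubmx (x i) 0 0 = 0.
    transitivity (lsubmx (row_mx 0 (2 *: u + 2 *: v) : 'rV[R]_(1 + d)) 0 0).
      by rewrite qE head_sum; apply: eq_bigr => j _; rewrite !mxE.
    by rewrite row_mxKl mxE.
  rewrite psumr_eq0 => [|j _]; last first.
    by rewrite mulr_ge0 ?(qform_c_ge0 (abc j)) ?hpos.
  by move=> /allP /(_ i (mem_index_enum _)) /eqP.
(* Adding the coefficients of [s ^+ 2] and [2 * s * t] cancels [v]. *)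
have mE : row_mx 1 m = \sum_i (a' i + b' i) *: x i.
  under eq_bigr do rewrite scalerDl.
  rewrite big_split /= -pE -rE add_row_mx addr0; congr row_mx.
  by apply/rowP => j; rewrite !mxE; ring.
(* Terms with [c' i = 0] have [b' i = 0] and lie in [C]. The others involve only facet vectors,
   since the coefficient of [t ^+ 2] has height 0; their sum is checked coordinatewise. *)
rewrite /P mE (bigID (fun i => c' i == 0)) /=.
apply: coneD (sc_cone hC) _ _ _ _.
  apply: cone_sum (sc_cone hC) _ _ _ _ (splitting_cone0 hC) _ => i /eqP ci.
  rewrite (qform_c0 (abc i) ci) addr0.
  exact: coneZ (sc_cone hC) _ _ (qform_a_ge0 (abc i)) (Cx i).
have xi i : c' i != 0 -> x i = row_mx 0 (rsubmx (x i)).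
  by move=> ci; apply: head0; have /eqP := c0 i; rewrite mulf_eq0 (negPf ci) => /eqP.
have xi0 i j : c' i != 0 -> 0 <= rsubmx (x i) 0 j.
  by move=> ci; apply: (hface _).1; rewrite -xi.
rewrite [X in C X](_ : _ =
    row_mx 0 (\sum_(i | c' i != 0) (a' i + b' i) *: rsubmx (x i))); last first.
  under eq_bigr => i ci do rewrite xi// scale_row_mx scaler0.
  elim/big_ind2: _ => [|y1 z1 y2 z2 -> ->|//]; first by rewrite row_mx0.
  by rewrite add_row_mx addr0.
apply/hface => j; rewrite summxE.
have bj : - 2 * v 0 j = \sum_(i | c' i != 0) b' i * rsubmx (x i) 0 j.
  have -> : - 2 * v 0 j =
      rsubmx (row_mx 0 (- 2 *: v) : 'rV[R]_(1 + d)) 0 j by rewrite row_mxKr mxE.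
  rewrite rE linear_sum summxE (bigID (fun i => c' i == 0))/= big1 ?add0r.
    by apply: eq_bigr => i _; rewrite linearZ mxE.
  by move=> i /eqP ci; rewrite (qform_c0 (abc i) ci) scale0r linear0 mxE.
have cj : 2 * (u 0 j + v 0 j) = \sum_(i | c' i != 0) c' i * rsubmx (x i) 0 j.
  have -> : 2 * (u 0 j + v 0 j) =
      rsubmx (row_mx 0 (2 *: u + 2 *: v) : 'rV[R]_(1 + d)) 0 j.
    by rewrite row_mxKr mxE [in RHS]mxE [X in _ = _ + X]mxE mulrDr.
  rewrite qE linear_sum summxE (bigID (fun i => c' i == 0))/= big1 ?add0r.
    by apply: eq_bigr => i _; rewrite linearZ mxE.
  by move=> i /eqP ci; rewrite ci scale0r linear0 mxE.
rewrite [X in 0 <= X](_ : _ =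
  \sum_(i | c' i != 0) a' i * rsubmx (x i) 0 j - 2 * v 0 j); last first.
  rewrite -mulNr bj -big_split/=.
  by apply: eq_bigr => i _; rewrite mxE mulrDl.
have [uj|vj] := uv j; last first.
  rewrite vj mulr0 subr0 sumr_ge0// => i ci.
  by rewrite mulr_ge0 ?(qform_a_ge0 (abc i)) ?xi0//.
(* If [u 0 j = 0], the sums [bj] and [cj] cancel; adding them turns the coefficients into values of
   the scalar forms at (1, 1). *)
rewrite [X in 0 <= X](_ : _ = \sum_(i | c' i != 0)
  (a' i + 2 * b' i + c' i) * rsubmx (x i) 0 j).
  apply: sumr_ge0 => i ci; rewrite mulr_ge0 ?xi0//.
  by have := abc i 1 1; lra.
under [RHS]eq_bigr do rewrite 2!mulrDl -mulrA.
rewrite 2!big_split/= -mulr_sumr -bj -cj uj; lra.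
Qed.

(** Closedness along a ray, drawn from the bidual property: a dual vector negative at [x] is still
    negative at [x + e *: z] for the small [e] chosen below. *)
Let C_limit (x z : 'rV[R]_(1 + d)) :
  (forall e : R, 0 < e -> C (x + e *: z)) -> C x.
Proof.
move=> Cxz; apply: (sc_bidual hC) => f Cf; rewrite leNgt; apply/negP => fx.
have k0 : 0 < 1 + dot f z ^+ 2 by have := sqr_ge0 (dot f z); lra.
pose e := - dot f x / (1 + dot f z ^+ 2).
have e0 : 0 < e by rewrite divr_gt0//; lra.
have ek : e * (1 + dot f z ^+ 2) = - dot f x by rewrite divfK// gt_eqF.
have := Cf _ (Cxz _ e0); rewrite !dot_lin.
have := sqr_ge0 (dot f z - 1); nra.
Qed.

Let P_inhabited : exists y, P y.
Proof.
have [a [b [Ca Cb ab]]] := sc_gen hC (row_mx 1 0).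
have a1 : 1 <= lsubmx a 0 0.
  have := hpos Cb; have /matrixP/(_ 0 0) := congr1 (@lsubmx R 1 1 d) ab.
  by rewrite row_mxKl linearB !mxE /=; lra.
have a0 : lsubmx a 0 0 != 0 by rewrite gt_eqF//; lra.
exists ((lsubmx a 0 0)^-1 *: rsubmx a).
rewrite /P.
have -> : row_mx 1 ((lsubmx a 0 0)^-1 *: rsubmx a) =
    (lsubmx a 0 0)^-1 *: a.
  rewrite -[in RHS](hsubmxK a) [in RHS]row_mxKl scale_row_mx; congr row_mx.
  by apply/rowP => i; rewrite ord1 [RHS]mxE mulVf// mxE eqxx.
by apply: coneZ (sc_cone hC) _ _ _ Ca; rewrite invr_ge0; lra.
Qed.

(** If coordinate [j] were unbounded below, minima with a fixed [b] would allow [b] to be lowered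
    arbitrarily in that coordinate; after rescaling, the limit puts minus a unit vector in the
    facet, against [hface]. *)
Let P_bounded j : exists L : R, forall y, P y -> L <= y 0 j.
Proof.
have [b Pb] := P_inhabited.
apply: contrapT => unb.
have {}unb L : exists2 y, P y & y 0 j < L.
  apply: contrapT => /forall2NP h; apply: unb; exists L => y Py.
  by have [//|/negP] := h y; rewrite -leNgt.
have /hface/(_ j) : C (row_mx 0 (- delta_mx 0 j)).
  apply: (@C_limit _ (row_mx 1 b)) => e e0.
  have -> : row_mx 0 (- delta_mx 0 j) + e *: row_mx 1 b =
      e *: row_mx 1 (b - e^-1 *: delta_mx 0 j) :> 'rV[R]_(1 + d).
    rewrite !scale_row_mx add_row_mx add0r scalerBr scalerA mulfV ?gt_eqF//.
    by rewrite scale1r addrC.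
  apply: coneZ (sc_cone hC) _ _ (ltW e0) _.
  have [y Py yj] := unb (b 0 j - e^-1).
  apply: (P_up (P_min Pb Py)) => i; rewrite !mxE eqxx/=.
  have [->|ij] := eqVneq i j; first by rewrite mulr1 ge_min (ltW yj) orbT.
  by rewrite mulr0 subr0 ge_min lexx.
by rewrite !mxE !eqxx oppr_ge0 ler10.
Qed.

Let P_minimum : exists2 m, P m & forall y, P y -> forall j, m 0 j <= y 0 j.
Proof.
have [b Pb] := P_inhabited.
pose S j := [set y 0 j | y in P].
have Sinf j : has_inf (S j).
  split; first by exists (b 0 j), b.
  by have [L LP] := P_bounded j; exists L => _ [y Py <-]; exact: LP.
pose m : 'rV[R]_d := \row_j inf (S j).
have mP y : P y -> forall j, m 0 j <= y 0 j.
  by move=> Py j; rewrite mxE; apply: ge_inf; [case: (Sinf j)|exists y].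
exists m => //; apply: (@C_limit _ (row_mx 0 (const_mx 1))) => e e0.
rewrite scale_row_mx scaler0 add_row_mx addr0.
have [y Py ym] : exists2 y, P y &
    forall j, j \in enum 'I_d -> y 0 j <= m 0 j + e.
  (* Successive minima bring one more coordinate at a time within [e] of its infimum, without
     raising the earlier ones. *)
  elim: (enum 'I_d) => [|j s [y Py ys]]; first by exists b.
  have [_ [z Pz <-] zj] := inf_adherent e0 (Sinf j).
  exists (\row_j Num.min (y 0 j) (z 0 j)); first exact: P_min.
  move=> i; rewrite inE => /orP[/eqP ->|/ys yi]; rewrite mxE.
    by rewrite ge_min [m 0 j]mxE (ltW zj) orbT.
  by rewrite ge_min yi.
apply: (P_up Py) => j; apply: le_trans (ym j (mem_enum _ _)) _.
by rewrite !mxE mulr1.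
Qed.

(** With [m] the least element of the slice, [C] is given by [0 <= h] and [h *: m <= y]
    coordinatewise; the matrix is the shear sending (h, y) to (h, y - h m). *)
Lemma orthant_of_facet_orthant : exists2 M : 'M[R]_(1 + d), M \in unitmx &
  forall x, C x <-> forall i, 0 <= (x *m M) 0 i.
Proof.
have [m Pm mP] := P_minimum.
exists (block_mx 1 (- m) 0 1%:M).
  by rewrite unitmxE det_ublock !det1 mulr1 unitr1.
move=> x; pose h := lsubmx x 0 0.
have hE : lsubmx x = h%:M by rewrite [LHS]mx11_scalar.
have xE : x = row_mx h%:M (rsubmx x) by rewrite -hE hsubmxK.
have xM : x *m block_mx 1 (- m) 0 1%:M = row_mx h%:M (rsubmx x - h *: m).
  rewrite {1}xE mul_row_block mulmx1 mulmx0 addr0 mulmx1 mul_scalar_mx.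
  by rewrite scalerN addrC.
have -> : (forall i, 0 <= (x *m block_mx 1 (- m) 0 1%:M) 0 i) <->
    0 <= h /\ forall j, h * m 0 j <= rsubmx x 0 j.
  rewrite xM; split=> [h0|[h0 xj] i].
    split; first by have := h0 (lshift d 0); rewrite row_mxEl mxE.
    by move=> j; have := h0 (rshift 1 j); rewrite row_mxEr !mxE subr_ge0.
  case: (split_ordP i) => j ->; first by rewrite row_mxEl ord1 mxE.
  by rewrite row_mxEr [X in 0 <= X]mxE [X in _ + X]mxE [X in _ - X]mxE subr_ge0.
split=> [Cx|[h0 xj]].
  have h0 : 0 <= h by exact: hpos.
  split=> // j; move: h0; rewrite le_eqVlt => /orP[/eqP h0|h0].
    rewrite -h0 mul0r; apply: (hface _).1; move: Cx; rewrite {1}xE -h0.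
    by rewrite raddf0.
  rewrite -ler_pdivlMl//.
  have := mP (h^-1 *: rsubmx x); rewrite /P.
  have -> : row_mx 1 (h^-1 *: rsubmx x) = h^-1 *: x.
    rewrite [in RHS]xE scale_row_mx; congr row_mx.
    by rewrite scale_scalar_mx mulVf// gt_eqF.
  move=> /(_ (coneZ (sc_cone hC) _ Cx)); rewrite invr_ge0 => /(_ (ltW h0) j).
  by rewrite mxE.
have -> : x = h *: row_mx 1 m + row_mx 0 (rsubmx x - h *: m).
  rewrite scale_row_mx add_row_mx addr0 addrC subrK {1}xE; congr row_mx.
  by rewrite scalemx1.
apply: coneD (sc_cone hC) _ _ (coneZ (sc_cone hC) h0 Pm) _.
by apply/hface => j; rewrite mxE [X in _ + X]mxE [X in _ - X]mxE subr_ge0.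
Qed.

End FirstCoordinate.

(** By the rank normal form, [f] is a nonzero scalar [k] times the first unit vector times an
    invertible [U]; [N] is the inverse transpose of [k *: U]. *)
Lemma unit_first_coordinate {R : realType} {d} (f : 'rV[R]_(1 + d)) : f != 0 ->
  exists2 N : 'M[R]_(1 + d), N \in unitmx &
    forall x, dot f (x *m N) = lsubmx x 0 0.
Proof.
move=> f0; have := mulmx_ebase f; rewrite rank_rV f0.
have := row_ebase_unit f; move: (row_ebase f) => U uU.
have := col_ebase_unit f; rewrite [col_ebase f]mx11_scalar.
move: (col_ebase f 0 0) => k; rewrite unitmxE det_scalar1 unitfE => k0 fE.
exists (k^-1 *: invmx U)^T.
  by rewrite unitmx_tr unitmxZ ?unitmx_inv// unitfE invr_eq0.
move=> x; rewrite dot_mulmx trmxK -scalemxAr -fE mulmxK// mul_scalar_mx.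
rewrite scalerA mulVf// scale1r -{1}(hsubmxK x) pid_mx_row tr_row_mx.
by rewrite mul_row_col mul0mx addr0 mul1mx mxE.
Qed.

Lemma splitting_cone_orthant {R : realType} d (C : set 'rV[R]_d) :
  splitting_cone C -> exists2 M : 'M[R]_d, M \in unitmx &
    forall x, C x <-> forall i, 0 <= (x *m M) 0 i.
Proof.
elim: d C => [|d IH] C hC.
  exists 1%:M; first exact: unitmx1.
  by move=> x; rewrite thinmx0; split=> [_ []//|_]; exact: splitting_cone0.
have [x0 [f [Cf f1 fx0 fmin]]] := dual_minimizer (ltn0Sn d) hC.
have f0 : f != 0.
  by apply/eqP => f0; move/eqP: f1; rewrite f0 dot0r eq_sym oner_eq0.
have [N uN NE] := @unit_first_coordinate _ d f f0.
pose C1 : set 'rV[R]_(1 + d) := [set x | C (x *m N)].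
have hC1 : splitting_cone C1 := splitting_cone_mulmx uN hC.
have pos1 x : C1 x -> 0 <= lsubmx x 0 0 by move=> /Cf; rewrite NE.
have [|M uM ME] := IH _ (splitting_cone_facet hC1 pos1 _).
  move=> w w0; have [|a [b [Ca Cb a0 b0 ab]]] :=
    facet_span hC Cf f1 fx0 fmin (w := w *m N); first by rewrite NE.
  exists (a *m invmx N), (b *m invmx N).
  by split; rewrite /C1 /= -?NE ?mulmxKV// -mulmxBl -ab mulmxK.
(* [K] makes the facet the standard orthant and keeps the first coordinate. *)
pose K : 'M[R]_(1 + d) := block_mx 1 0 0 (invmx M).
have uK : K \in unitmx.
  by rewrite unitmxE det_ublock det1 mul1r -unitmxE unitmx_inv.
have KE x : x *m K = row_mx (lsubmx x) (rsubmx x *m invmx M).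
  by rewrite -{1}(hsubmxK x) mul_row_block !mulmx0 addr0 add0r mulmx1.
pose C2 : set 'rV[R]_(1 + d) := [set x | C1 (x *m K)].
have hC2 : splitting_cone C2 := splitting_cone_mulmx uK hC1.
have pos2 x : C2 x -> 0 <= lsubmx x 0 0.
  by move=> /pos1; rewrite KE row_mxKl.
have face2 y : C2 (row_mx 0 y) <-> forall i, 0 <= y 0 i.
  rewrite /C2 /= KE row_mxKl row_mxKr; have := ME (y *m invmx M).
  by rewrite mulmxKV.
have [L uL LE] := orthant_of_facet_orthant hC2 pos2 face2.
exists (invmx N *m invmx K *m L); first by rewrite !unitmx_mul !unitmx_inv uN uK.
move=> x; have := LE (x *m invmx N *m invmx K).
by rewrite /C2 /C1 /= !mulmxKV// !mulmxA.
Qed.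

Local Open Scope complex_scope.
Local Open Scope sesquilinear_scope.

(** * Hermitian forms and positive semidefinite matrices *)

Section HermitianForms.
Context {R : realType} {n : nat}.
Implicit Types (v : 'cV[R[i]]_n) (H G : herm R n).

Definition hform v H : R[i] := (v ^t* *m herm_mx H *m v) 0 0.

Lemma hformD v H G : hform v (H + G) = hform v H + hform v G.
Proof. by rewrite /hform herm_mxD mulmxDr mulmxDl mxE. Qed.

Lemma hformZ v a H : hform v (a *: H) = a%:C * hform v H.
Proof. by rewrite /hform herm_mxZ -scalemxAr -scalemxAl mxE. Qed.

Lemma ReD (x y : R[i]) : complex.Re (x + y) = complex.Re x + complex.Re y.
Proof. by case: x y => ? ? []. Qed.

Lemma Re_realM (a : R) (x : R[i]) : complex.Re (a%:C * x) = a * complex.Re x.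
Proof. by case: x => x y /=; rewrite mul0r subr0. Qed.

Lemma hform_real v H : complex.Im (hform v H) = 0.
Proof.
have : (hform v H)^* = hform v H.
  rewrite /hform; set M := _ *m _ *m _.
  have {2}-> : M = M ^t*.
    have vv : (v ^t*)^T ^ Num.conj = v by apply/matrixP => i j; rewrite !mxE conjCK.
    by rewrite /M !trmx_mul !map_mxM vv mulmxA -(is_hermP _ (valP H)).
  by rewrite !mxE.
by case: (hform v H) => x y [] /= h; lra.
Qed.

(** The order on [R[i]] also compares imaginary parts; these vanish by [hform_real]. *)
Lemma PSD_Re H : PSD H <-> forall v, 0 <= complex.Re (hform v H).
Proof.
split=> h v; first by have := h v; rewrite lecE => /andP[].
by rewrite lecE /= (hform_real v H) eqxx /= h.
Qed.

Fact Re_hform_is_scalar v : scalar (fun H => complex.Re (hform v H)).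
Proof. by move=> a H G; rewrite hformD hformZ raddfD /= -Re_realM. Qed.

Definition Re_hform v : {scalar herm R n} :=
  HB.pack (fun H => complex.Re (hform v H))
    (GRing.isLinear.Build _ _ _ _ _ (Re_hform_is_scalar v)).

Lemma Re_hform_comb v a b c H G K :
  complex.Re (hform v (a *: H + b *: G + c *: K)) =
  a * complex.Re (hform v H) + b * complex.Re (hform v G)
  + c * complex.Re (hform v K).
Proof. by rewrite 2!hformD 3!hformZ 2!ReD 3!Re_realM. Qed.

End HermitianForms.

(** * Minimal and maximal tensor products *)

Section MinMaxTensor.
Context {R : realType} {d : nat} {V : lmodType R}.
Variables (C1 : set 'rV[R]_d) (C2 : set V).

Lemma tens_fun_lin (f : {scalar 'rV[R]_d}) (g : {scalar V}) a b
    (y z : {ffun 'I_d -> V}) :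
  tens_fun f g (a *: y + b *: z) = a * tens_fun f g y + b * tens_fun f g z.
Proof.
rewrite /tens_fun !mulr_sumr -big_split /=; apply: eq_bigr => i _.
by rewrite !ffunE linearD !linearZ /=; ring.
Qed.

Lemma tens_funD (f : {scalar 'rV[R]_d}) (g : {scalar V})
    (y z : {ffun 'I_d -> V}) :
  tens_fun f g (y + z) = tens_fun f g y + tens_fun f g z.
Proof. by have := tens_fun_lin f g 1 1 y z; rewrite !scale1r !mul1r. Qed.

Lemma tens_funZ (f : {scalar 'rV[R]_d}) (g : {scalar V}) a (z : {ffun 'I_d -> V}) :
  tens_fun f g (a *: z) = a * tens_fun f g z.
Proof. by have := tens_fun_lin f g a 0 z 0; rewrite scaler0 mul0r !addr0. Qed.

Lemma min_tensor_sub_max : min_tensor C1 C2 `<=` max_tensor C1 C2.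
Proof.
move=> _ [N [w [p [w0 _ Cp ->]]]] f g Cf Cg.
elim/big_ind: _ => [|y z fy fz|i _].
- have -> : 0 = tens 0 0 :> {ffun 'I_d -> V}.
    by apply/ffunP => i; rewrite !ffunE scaler0.
  by rewrite tens_funE linear0 mul0r.
- by rewrite tens_funD addr_ge0.
- have [x Cx [y Cy <-]] := Cp i.
  by rewrite tens_funZ tens_funE; apply: mulr_ge0 => //;
    apply: mulr_ge0; [exact: Cf|exact: Cg].
Qed.

Lemma min_tensor_sum (N : nat) (x : 'I_N -> 'rV[R]_d) (y : 'I_N -> V) :
  is_cone C1 -> C1 0 -> C2 0 -> (forall i, C1 (x i)) -> (forall i, C2 (y i)) ->
  min_tensor C1 C2 (\sum_i tens (x i) (y i)).
Proof.
move=> hC C10 C20 Cx Cy; have N0 : N.+1%:R != 0 :> R by rewrite pnatr_eq0.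
(* The uniform weights of the convex combination are compensated by scaling the cone vectors by
   [N.+1]; the extra zero tensor covers [N = 0]. *)
pose p i : {ffun 'I_d -> V} :=
  if unlift ord0 i is Some j then tens (N.+1%:R *: x j) (y j) else tens 0 0.
exists N.+1, (fun=> N.+1%:R^-1), p; split.
- by move=> i; rewrite invr_ge0 ler0n.
- rewrite sumr_const card_ord -[LHS]mulr_natr mulVf//.
- move=> i; rewrite /p; case: unliftP => [j _|_].
    by exists (N.+1%:R *: x j); [apply: coneZ; rewrite ?ler0n|exists (y j)].
  by exists 0 => //; exists 0.
- rewrite big_ord_recl /p unlift_none.
  have -> : tens 0 0 = 0 :> {ffun 'I_d -> V}.
    by apply/ffunP => i; rewrite !ffunE scaler0.
  rewrite scaler0 add0r; apply: eq_bigr => i _; rewrite liftK.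
  by apply/ffunP => j; rewrite !ffunE mxE !scalerA mulrA mulVf ?mul1r.
Qed.

End MinMaxTensor.

Section ClassicalSplits.
Context {R : realType} {d n : nat}.
Variable C : set 'rV[R]_d.

Lemma PSD0 : PSD (0 : herm R n).
Proof. by apply/PSD_Re => v; have /= -> := linear0 (Re_hform v). Qed.

(** The coordinate functionals [f i] of the basis lie in the dual cone. Expanding [z] along the
    basis, its coefficients [Z i] are positive semidefinite because [z] is nonnegative against [f i]
    paired with each [Re_hform v]. *)
Lemma classical_max_sub_min : classical_cone C ->
  opsys_max C n `<=` opsys_min C n.
Proof.
move=> [A [bA CE]] z zmax.
have [/eqP sA fA] : <<A>>%VS == fullv /\ free A by move/andP: bA.
have [f [gen_f fA_delta]] : exists f : 'I_(size A) -> {scalar 'rV[R]_d},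
    (forall x, x = \sum_i f i x *: A`_i) /\
    (forall i (j : 'I_(size A)), f i A`_j = (j == i)%:R).
  exists (coord (in_tuple A)); split=> [x|i j].
    by apply: (coord_span (X := in_tuple A)); rewrite sA memvf.
  exact: (coord_free (X := in_tuple A)).
have C0 : C 0.
  rewrite CE; exists (fun=> 0) => //; by rewrite big1// => i _; rewrite scale0r.
have CA (i : 'I_(size A)) : C A`_i.
  rewrite CE; exists (fun j => (j == i)%:R) => [j|]; first by rewrite ler0n.
  rewrite (bigD1 i)//= eqxx scale1r big1 ?addr0// => j /negPf ->.
  by rewrite scale0r.
have Cf i : dual_cone C (f i).
  move=> x; rewrite CE => -[c /= c0 <-]; rewrite linear_sum (bigD1 i)//= big1.
    by rewrite linearZ /= fA_delta eqxx mulr1 addr0.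
  by move=> j ji; rewrite linearZ /= fA_delta (negPf ji) mulr0.
have hC : is_cone C.
  move=> x y s t Cx Cy s0 t0; rewrite CE.
  exists (fun i => f i (s *: x + t *: y)); last by rewrite -gen_f.
  by move=> i /=; rewrite linearD !linearZ /= addr_ge0// mulr_ge0// Cf.
pose Z i := \sum_j f i (delta_mx 0 j) *: z j.
have -> : z = \sum_(i < size A) tens A`_i (Z i).
  apply/ffunP => k; rewrite sum_ffunE.
  under eq_bigr do rewrite ffunE scaler_sumr.
  rewrite exchange_big /=.
  transitivity (\sum_j (delta_mx 0 j : 'rV[R]_d) 0 k *: z j).
    rewrite (bigD1 k)//= big1 => [|j jk]; last first.
      by rewrite mxE eq_sym (negPf jk) scale0r.
    by rewrite mxE !eqxx scale1r addr0.
  apply: eq_bigr => j _; rewrite {1}(gen_f (delta_mx 0 j)) summxE scaler_suml.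
  by apply: eq_bigr => i _; rewrite mxE mulrC scalerA.
apply: min_tensor_sum => // [|i]; first exact: PSD0.
apply/PSD_Re => v; have Cv : dual_cone (@PSD R n) (Re_hform v).
  by move=> H /PSD_Re hH; exact: hH.
have := zmax (f i) (Re_hform v) (Cf i) Cv.
suff -> : tens_fun (f i) (Re_hform v) z = Re_hform v (Z i) by [].
by rewrite linear_sum; apply: eq_bigr => j _; rewrite linearZ.
Qed.

End ClassicalSplits.

(** * Real symmetric 2x2 blocks inside Hermitian matrices *)

Lemma form_delta (F : comNzRingType) n (a : 'rV[F]_n) (b : 'cV[F]_n) i j :
  (a *m delta_mx i j *m b) 0 0 = a 0 i * b j 0.
Proof.
rewrite -(mul_delta_mx (0 : 'I_1)) mulmxA -mulmxA -colE -rowE.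
by rewrite mxE big_ord1 !mxE.
Qed.

Lemma form_deltaD (F : comNzRingType) n (a : 'rV[F]_n) (b : 'cV[F]_n) i j :
  (a *m (delta_mx i j + delta_mx j i) *m b) 0 0 = a 0 i * b j 0 + a 0 j * b i 0.
Proof. by rewrite mulmxDr mulmxDl [LHS]mxE !form_delta. Qed.

Lemma delta_form (F : comNzRingType) n (M : 'M[F]_n) i j :
  ((delta_mx 0 i : 'rV_n) *m M *m (delta_mx j 0 : 'cV_n)) 0 0 = M i j.
Proof. by rewrite -rowE -colE !mxE. Qed.

Lemma form_expand (F : comNzRingType) n (x y : F) (a b : 'rV[F]_n)
    (a' b' : 'cV[F]_n) (M : 'M[F]_n) :
  ((x *: a + y *: b) *m M *m (x *: a' + y *: b')) 0 0 =
  x * x * (a *m M *m a') 0 0 + x * y * (a *m M *m b') 0 0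
  + y * x * (b *m M *m a') 0 0 + y * y * (b *m M *m b') 0 0.
Proof.
by rewrite !(mulmxDl, mulmxDr) -!(scalemxAl, scalemxAr) !mxE; ring.
Qed.

Section SplittingFromTensor.
Context {R : realType} {d n : nat}.
Variables (i0 i1 : 'I_n).
Hypothesis i01 : i0 != i1.

Let delta_herm (i : 'I_n) : (delta_mx i i : 'M[R[i]]_n) \in @is_herm R n.
Proof. by apply/is_hermP; rewrite trmx_delta map_delta_mx. Qed.

Let sym_herm : (delta_mx i0 i1 + delta_mx i1 i0 : 'M[R[i]]_n) \in @is_herm R n.
Proof.
apply/is_hermP; rewrite raddfD /= map_mxD !trmx_delta !map_delta_mx.
by rewrite addrC.
Qed.

Let HA : herm R n := Herm (delta_herm i0).
Let HB : herm R n := Herm sym_herm.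
Let HC : herm R n := Herm (delta_herm i1).

Let HAE : herm_mx HA = delta_mx i0 i0. Proof. by []. Qed.
Let HBE : herm_mx HB = delta_mx i0 i1 + delta_mx i1 i0. Proof. by []. Qed.
Let HCE : herm_mx HC = delta_mx i1 i1. Proof. by []. Qed.

(** At a complex vector, the Hermitian form is the real form at the real parts plus the real form at
    the imaginary parts. *)
Let PSD_qform a b c :
  (forall s t : R, 0 <= s ^+ 2 * a + 2 * s * t * b + t ^+ 2 * c) ->
  PSD (a *: HA + b *: HB + c *: HC).
Proof.
move=> abc; apply/PSD_Re => v.
rewrite Re_hform_comb /hform HAE HBE HCE.
rewrite (form_delta (v ^t*) v i0 i0) (form_delta (v ^t*) v i1 i1).
rewrite (form_deltaD (v ^t*) v i0 i1).
have vE i : (v ^t*) 0 i = (v i 0)^* by rewrite !mxE.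
rewrite !vE.
case: (v i0 0) (v i1 0) => [x y] [x' y'] /=.
by have := abc x x'; have := abc y y'; lra.
Qed.

Let entry_sum (i j : 'I_n) N (w : 'I_N -> R) (G : 'I_N -> herm R n) :
  complex.Re (herm_mx (\sum_k w k *: G k) i j) =
  \sum_k w k * complex.Re (herm_mx (G k) i j).
Proof.
elim/big_ind2: _ => [|x y x' y' <- <-|k _]; first by rewrite mxE.
  by rewrite herm_mxD mxE ReD.
by rewrite herm_mxZ mxE Re_realM.
Qed.

Let entry3 (i j : 'I_n) a b c :
  complex.Re (herm_mx (a *: HA + b *: HB + c *: HC) i j) =
  a * ((i == i0) && (j == i0))%:R +
  b * (((i == i0) && (j == i1))%:R + ((i == i1) && (j == i0))%:R) +
  c * ((i == i1) && (j == i1))%:R.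
Proof.
rewrite !herm_mxD !herm_mxZ HAE HBE HCE.
rewrite !mxE !ReD !Re_realM !ReD.
have ReB (e : bool) : complex.Re (e%:R : R[i]) = e%:R by case: e.
by rewrite !ReB.
Qed.

(** On real vectors supported on [i0] and [i1], the imaginary parts of the two conjugate
    off-diagonal entries cancel. *)
Lemma PSD_block (G : herm R n) : PSD G -> forall s t : R,
  0 <= s ^+ 2 * complex.Re (herm_mx G i0 i0)
     + 2 * s * t * complex.Re (herm_mx G i0 i1)
     + t ^+ 2 * complex.Re (herm_mx G i1 i1).
Proof.
move=> /PSD_Re hG s t.
have G10 : herm_mx G i1 i0 = (herm_mx G i0 i1)^*.
  by have /is_hermP GE := valP G; rewrite [in LHS]GE !mxE.
have := hG (s%:C *: delta_mx i0 0 + t%:C *: delta_mx i1 0); rewrite /hform.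
have -> : (s%:C *: delta_mx i0 0 + t%:C *: delta_mx i1 0) ^t* =
    s%:C *: delta_mx 0 i0 + t%:C *: delta_mx 0 i1 :> 'rV[R[i]]_n.
  rewrite raddfD /= !linearZ /= map_mxD !map_mxZ !trmx_delta !map_delta_mx.
  by congr (_ *: _ + _ *: _); exact: conjc_real.
rewrite form_expand (delta_form (herm_mx G) i0 i0) (delta_form (herm_mx G) i0 i1).
rewrite (delta_form (herm_mx G) i1 i0) (delta_form (herm_mx G) i1 i1) G10.
case: (herm_mx G i0 i0) (herm_mx G i0 i1) (herm_mx G i1 i1) =>
  [a a'] [b b'] [c c'] /=.
lra.
Qed.

Lemma splitting_of_max_sub_min (C : set 'rV[R]_d) : is_cone C ->
  opsys_max C n `<=` opsys_min C n -> quadratic_splitting C.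
Proof.
move=> hC sub p r q Cpq.
(* The quadratic form becomes a tensor; applying [f] to it leaves a matrix whose form is [f]
   evaluated in [C], so [z] is in the maximal product. *)
pose z : {ffun 'I_d -> herm R n} := tens p HA + tens r HB + tens q HC.
have /sub[N [w [y [w0 _ Cy zE]]]] : opsys_max C n z.
  move=> f g Cf Cg; rewrite /z !tens_funD !tens_funE.
  have := Cg (f p *: HA + f r *: HB + f q *: HC).
  rewrite !linearD !linearZ; apply; apply: PSD_qform => s t.
  by have := Cf _ (Cpq s t); rewrite !linearD !linearZ.
have /choice[x /choice[G xP]] : forall i, exists x, exists G : herm R n,
    [/\ C x, PSD G & y i = tens x G].
  by move=> i; have [x Cx [G PG <-]] := Cy i; exists x, G.
have zj i j k : complex.Re (herm_mx (z k) i j) =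
    \sum_l w l * complex.Re (herm_mx (G l) i j) * x l 0 k.
  rewrite zE sum_ffunE.
  have -> : \sum_l (w l *: y l) k = \sum_l (w l * x l 0 k) *: G l.
    by apply: eq_bigr => l _; have [_ _ ->] := xP l; rewrite !ffunE scalerA.
  by rewrite entry_sum; apply: eq_bigr => l _; rewrite mulrAC.
have zk k : z k = p 0 k *: HA + r 0 k *: HB + q 0 k *: HC by rewrite !ffunE.
have i10 : (i1 == i0) = false by rewrite eq_sym (negPf i01).
(* The block entries of the separable decomposition, with the convex weights absorbed, are the
   scalar forms. *)
exists N, x, (fun l => w l * complex.Re (herm_mx (G l) i0 i0)),
  (fun l => w l * complex.Re (herm_mx (G l) i0 i1)),
  (fun l => w l * complex.Re (herm_mx (G l) i1 i1)); split.
- by move=> l; have [] := xP l.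
- move=> l s t; have [_ /PSD_block/(_ s t) h _] := xP l.
  by have := mulr_ge0 (w0 l) h; lra.
- apply/rowP => k; have := zj i0 i0 k; rewrite zk entry3 !eqxx ?(negPf i01) ?i10 /=.
  rewrite !(mulr0, mulr1, addr0, add0r) => ->; rewrite summxE.
  by apply: eq_bigr => l _; rewrite mxE.
- apply/rowP => k; have := zj i0 i1 k; rewrite zk entry3 !eqxx ?(negPf i01) ?i10 /=.
  rewrite !(mulr0, mulr1, addr0, add0r) => ->; rewrite summxE.
  by apply: eq_bigr => l _; rewrite mxE.
- apply/rowP => k; have := zj i1 i1 k; rewrite zk entry3 !eqxx ?(negPf i01) ?i10 /=.
  rewrite !(mulr0, mulr1, addr0, add0r) => ->; rewrite summxE.
  by apply: eq_bigr => l _; rewrite mxE.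
Qed.

End SplittingFromTensor.

(** * From the splitting property to a generating basis *)

Lemma proper_cone_splitting {R : realType} {d} (C : set 'rV[R]_d) :
  proper_cone C -> quadratic_splitting C -> splitting_cone C.
Proof.
move=> [hC clC pC gC] sC; split => //.
- apply: closed_cone_bidual => //.
  by have : [set 0 : 'rV[R]_d] 0 by []; rewrite -pC => -[].
- move=> x Cx CNx; have : (C `&` [set - x | x in C]) x.
    by split=> //; exists (- x); rewrite ?opprK.
  by rewrite pC.
- move=> x; have : [set: 'rV[R]_d] x by [].
  by rewrite -gC => -[a Ca [b Cb <-]]; exists a, b.
Qed.

(** The rows of [invmx M] are sent by [M] to the unit vectors, so they form the basis in which [x]
    has coordinates [x *m M]. *)
Lemma orthant_classical {R : realType} {d} (C : set 'rV[R]_d) (M : 'M[R]_d) :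
  is_cone C -> M \in unitmx -> (forall x, C x <-> forall i, 0 <= (x *m M) 0 i) ->
  classical_cone C.
Proof.
move=> hC uM CM; pose A := [tuple row i (invmx M) | i < d].
have AE (i : 'I_d) : A`_i = row i (invmx M) by rewrite -tnth_nth tnth_mktuple.
have decomp x : x = \sum_(i < d) (x *m M) 0 i *: row i (invmx M).
  by rewrite -mulmx_sum_row mulmxK.
have sumE (F : 'I_d -> R) :
    \sum_(i < size A) F (cast_ord (size_tuple A) i) *: A`_i =
    \sum_(i < d) F i *: row i (invmx M).
  rewrite [RHS](reindex (cast_ord (size_tuple A))) /=; last first.
    by apply: onW_bij; exists (cast_ord (esym (size_tuple A))) => i;
      rewrite ?cast_ordK ?cast_ordKV.
  by apply: eq_bigr => i _; rewrite -AE.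
exists A; split.
  rewrite basisEdim size_tuple dimvf /dim /= mul1n leqnn andbT.
  apply/subvP => x _; rewrite (decomp x); apply: memv_suml => i _.
  by apply: memvZ; apply: memv_span; rewrite -AE mem_nth// size_tuple.
apply/seteqP; split=> [x /CM x0|_ [c /= c0 <-]].
  exists (fun i => (x *m M) 0 (cast_ord (size_tuple A) i)) => [i|].
    exact: x0.
  by rewrite (sumE (fun i => (x *m M) 0 i)) -decomp.
have C0 : C 0 by apply/CM => i; rewrite mul0mx mxE.
apply: cone_sum (hC) _ _ _ _ C0 _ => i _; apply: coneZ (hC) _ _ (c0 i) _.
have -> : A`_i = row (cast_ord (size_tuple A) i) (invmx M) by rewrite -AE.
by apply/CM => j; rewrite -row_mul mulVmx// !mxE ler0n.
Qed.

Theorem corollary2 (R : realType) (d : nat) (C : set 'rV[R]_d)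
    (hC : proper_cone C) (n : nat) (hn : (2 <= n)%N) :
  opsys_min C n = opsys_max C n <-> classical_cone C.
Proof.
split=> [minmax|Ccl]; last first.
  apply/seteqP; split; first exact: min_tensor_sub_max.
  exact: classical_max_sub_min.
have cC : is_cone C by case: hC.
have [M uM CM] : exists2 M : 'M[R]_d, M \in unitmx &
    forall x, C x <-> forall i, 0 <= (x *m M) 0 i.
  apply/splitting_cone_orthant/proper_cone_splitting => //.
  (* [2 <= n] provides the distinct indices 0 and 1 of the block. *)
  apply: (@splitting_of_max_sub_min _ _ n (Ordinal (ltnW hn)) (Ordinal hn)) => //.
  by rewrite minmax.
exact: orthant_classical uM CM.
Qed.
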